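(* Let $\alpha\in(0,1)$ and let $A,B$ be finite-dimensional quantum systems. For a quantum channel $\Phi(\rho)=\sum_iK_i\rho K_i^\dagger$ ($\sum_iK_i^\dagger K_i=\mathrm{I}$) and a state $\rho$ set $T_\alpha(\rho,\Phi)=1-\mathrm{tr}\,\rho^\alpha\Phi(\rho^{1-\alpha})$, and for a bipartite state $\rho_{AB}$ with $\rho_A=\mathrm{tr}_B\rho_{AB}$ and a channel $\Phi_A$ on $A$ define $$D^T_\alpha(\rho_{AB}|\Phi_A)=T_\alpha(\rho_{AB},\Phi_A\otimes\mathcal{I}_B)-T_\alpha(\rho_A,\Phi_A),$$ where $\mathcal{I}_B$ is the identity channel on $B$. Then: (i) $D^T_\alpha(\rho_{AB}|\Phi_A)\ge0$, with equality when $\rho_{AB}=\rho_A\otimes\rho_B$ is a product state. (ii) For any unitaries $U_A$ on $A$ and $U_B$ on $B$, $D^T_\alpha\big((U_A\otimes U_B)\rho_{AB}(U_A\otimes U_B)^\dagger\,\big|\,\Phi_A\big)=D^T_\alpha(\rho_{AB}|\mathcal{U}_A^\dagger\Phi_A\mathcal{U}_A)$, where $\mathcal{U}_A^\dagger\Phi_A\mathcal{U}_A(\rho_A)=\sum_i(U_A^\dagger K_iU_A)\rho_A(U_A^\dagger K_iU_A)^\dagger$ for $\Phi_A(\rho)=\sum_iK_i\rho K_i^\dagger$. (iii) For any channel $\Phi_B$ on $B$, $D^T_\alpha\big((\mathcal{I}_A\otimes\Phi_B)(\rho_{AB})\,\big|\,\Phi_A\big)\le D^T_\alpha(\rho_{AB}|\Phi_A)$,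 where $\mathcal{I}_A$ is the identity channel on $A$.
   Context: $\rho^\alpha$ denotes the functional-calculus power of the positive operator $\rho$. The channel $\Phi_A\otimes\mathcal{I}_B$ has Kraus operators $K_i\otimes\mathrm{I}_B$. *)

(* Defs.v *)
From HB Require Import structures.
From mathcomp Require Import all_boot all_order all_algebra.
From mathcomp Require Import sesquilinear spectral.
From mathcomp Require Import complex mxtens.
From mathcomp Require Import reals exp.

Set Implicit Arguments.
Unset Strict Implicit.
Unset Printing Implicit Defensive.

Import Order.TTheory GRing.Theory Num.Theory.
Local Open Scope ring_scope.
Local Open Scope sesquilinear_scope.

Section QDefs.
Variable R : realType.
Local Notation C := (R[i]).

Definition adj {m n} (A : 'M[C]_(m, n)) : 'M[C]_(n, m) := A ^t*.

Definition psdmx {n} (A : 'M[C]_n) : Prop :=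
  A \is hermsymmx /\ forall v : 'rV[C]_n, 0 <= (v *m A *m adj v) 0 0.

Definition is_state {n} (rho : 'M[C]_n) : Prop := psdmx rho /\ \tr rho = 1.

(* functional-calculus power rho^a of a positive operator, via the
   spectral decomposition rho = P^-1 diag(sp) P provided by spectral.v *)
Definition mxpowR {n} (A : 'M[C]_n) (a : R) : 'M[C]_n :=
  invmx (spectralmx A)
  *m diag_mx (map_mx (fun c : C => (((complex.Re c) `^ a)%:C)%C) (spectral_diag A))
  *m spectralmx A.

Definition is_channel {n r} (K : 'I_r -> 'M[C]_n) : Prop :=
  \sum_(i < r) adj (K i) *m K i = 1%:M.

Definition apply_ch {n r} (K : 'I_r -> 'M[C]_n) (rho : 'M[C]_n) : 'M[C]_n :=
  \sum_(i < r) K i *m rho *m adj (K i).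

Definition ch_tens_id {nA nB r} (K : 'I_r -> 'M[C]_nA) : 'I_r -> 'M[C]_(nA * nB) :=
  fun i => K i *t (1%:M : 'M[C]_nB).
Definition id_tens_ch {nA nB r} (L : 'I_r -> 'M[C]_nB) : 'I_r -> 'M[C]_(nA * nB) :=
  fun i => (1%:M : 'M[C]_nA) *t L i.

Definition ch_conj {n r} (U : 'M[C]_n) (K : 'I_r -> 'M[C]_n) : 'I_r -> 'M[C]_n :=
  fun i => adj U *m K i *m U.

Definition ptraceB {nA nB} (X : 'M[C]_(nA * nB)) : 'M[C]_nA :=
  \matrix_(i, j) \sum_(k < nB) X (mxtens_index (i, k)) (mxtens_index (j, k)).

Definition T_alpha {n r} (a : R) (rho : 'M[C]_n) (K : 'I_r -> 'M[C]_n) : C :=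
  1 - \tr (mxpowR rho a *m apply_ch K (mxpowR rho (1 - a))).

Definition DT_alpha {nA nB r} (a : R) (rho : 'M[C]_(nA * nB))
  (K : 'I_r -> 'M[C]_nA) : C :=
  T_alpha a rho (@ch_tens_id nA nB r K) - T_alpha a (ptraceB rho) K.

End QDefs.

(* Main.v *)
(* In the eigenbasis of rho, with eigenvalues l_i and X_ij the entries of X,
   tr (f(rho) X g(rho) X^* ) = sum_ij f(l_i) g(l_j) |X_ij|^2.  For a weight w(x, y)
   consider the form Q_w(rho; X) = sum_ij w(l_i, l_j) |X_ij|^2, and call w monotone if
   Q_w(rho; Phi^*(X)) <= Q_w(Phi(rho); X) for the channel Phi with Heisenberg dual
   Phi^*.  The weights x and y are monotone by the Schwarz inequality for Phi^*, and
   monotonicity is preserved by arithmetic means, by pointwise limits, and by harmonic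
   means, since the form of a harmonic mean is the infimum of 2 (Q_f(Y) + Q_g(Z)) over
   Y + Z = X.  Iterating arithmetic and harmonic means gives geometric means, hence
   x^a y^(1-a) for dyadic a, hence for all a.  Applied to the partial trace, whose dual
   is X |-> X (x) I, this gives the positivity of D; applied to I (x) Phi_B, whose dual
   fixes K (x) I, it gives (iii). *)
Require Import Defs.
From HB Require Import structures.
From mathcomp Require Import all_boot all_order all_algebra.
From mathcomp Require Import sesquilinear spectral.
From mathcomp Require Import complex mxtens.
From mathcomp Require Import reals exp.
From mathcomp Require Import boolp classical_sets topology normedtype sequences.
From mathcomp Require Import ring lra.

Set Implicit Arguments.
Unset Strict Implicit.
Unset Printing Implicit Defensive.

Import Order.TTheory GRing.Theory Num.Theory.
Import numFieldNormedType.Exports.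
Local Open Scope ring_scope.

(** * Classes of weights closed under means and limits contain the power weights *)

Section ClosureUnderMeans.
Local Open Scope classical_set_scope.
Variable R : realType.
Implicit Types (x y s t : R) (f g : R -> R -> R).

(* The harmonic mean, with value 0 at (0, 0). *)
Definition harm x y : R := (x * y) / (2^-1 * (x + y)).

(** Only the closed quadrant matters: weights are evaluated at eigenvalues of positive matrices. *)
Definition quadrant_cvg (u : nat -> R -> R -> R) f :=
  forall x y, 0 <= x -> 0 <= y -> (fun n => u n x y) @ \oo --> f x y.

Lemma ahm_step (s c d : R) : 0 <= c -> 0 <= d -> s ^+ 2 = c * d ->
  let c' := 2^-1 * (c + d) in let d' := harm c d in
  [/\ 0 <= c', 0 <= d', s ^+ 2 = c' * d' & `|c' - d'| <= 2^-1 * `|c - d|].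
Proof.
move=> c0 d0 sE; rewrite /= /harm.
have [cd0|cd0] := eqVneq (c + d) 0.
  have -> : c = 0 by lra.
  have -> : d = 0 by lra.
  by rewrite !(mul0r, mulr0, addr0, subr0, normr0) sE; split => //; nra.
have cdp : 0 < c + d by rewrite lt_neqAle eq_sym cd0 addr_ge0.
split.
- by lra.
- by rewrite divr_ge0 ?mulr_ge0 //; lra.
- by rewrite sE; field.
- have -> : 2^-1 * (c + d) - c * d / (2^-1 * (c + d))
            = 2^-1 * (c - d) * ((c - d) / (c + d)).
    by field.
  rewrite !normrM !normfV (gtr0_norm cdp) normr_nat.
  rewrite ler_piMr // ?mulr_ge0 ?invr_ge0 ?ler0n // ler_pdivrMr // mul1r.
  by rewrite ler_norml; lra.
Qed.

(* Arithmetic-harmonic mean iteration: the product of the two entries is invariant,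
   so both converge to the geometric mean. *)
Fixpoint ahm (n : nat) x y : R * R :=
  if n is k.+1 then
    let: (c, d) := ahm k x y in (2^-1 * (c + d), harm c d)
  else (x, y).

Lemma ahm_bound n x y s : 0 <= x -> 0 <= y -> s ^+ 2 = x * y ->
  [/\ 0 <= (ahm n x y).1, 0 <= (ahm n x y).2,
      s ^+ 2 = (ahm n x y).1 * (ahm n x y).2 &
      `|(ahm n x y).1 - (ahm n x y).2| <= `|x - y| * 2^-1 ^+ n].
Proof.
move=> x0 y0 sE; elim: n => [|n] /=; first by rewrite expr0 mulr1.
case: (ahm n x y) => c d /= [c0 d0 scd cd].
have [h1 h2 h3 h4] := @ahm_step s c d c0 d0 scd; split=> //.
rewrite (le_trans h4) // exprSr mulrA [leRHS]mulrC.
by rewrite ler_wpM2l // invr_ge0 ler0n.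
Qed.

(** The square root [s] lies between the two entries, whose product is [s ^+ 2], so its distance to
    the first is at most their gap, which decays geometrically. *)
Lemma ahm_cvg x y : 0 <= x -> 0 <= y ->
  (fun n => (ahm n x y).1) @ \oo --> Num.sqrt (x * y).
Proof.
move=> x0 y0; set s := Num.sqrt _.
have s0 : 0 <= s by exact: sqrtr_ge0.
have sE : s ^+ 2 = x * y by rewrite sqr_sqrtr // mulr_ge0.
have key n : `|(ahm n x y).1 - s| <= geometric `|x - y| 2^-1 n.
  have [c0 d0 scd cd] := @ahm_bound n x y s x0 y0 sE.
  apply: le_trans cd; move: c0 d0 scd.
  move: (ahm n x y).1 (ahm n x y).2 => c d c0 d0 scd.
  have [sc|sc] := leP s c.
    rewrite (ger0_norm (_ : 0 <= c - s)); last by lra.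
    have [ds|ds] := leP d s; first by rewrite ger0_norm; lra.
    (* Both entries are at least [s] here, the second strictly; the product [s ^+ 2] then forces
       [c = s]. *)
    have -> : c = s by apply/eqP; rewrite eq_le sc andbT; nra.
    by rewrite subrr.
  rewrite (ltr0_norm (_ : c - s < 0)); last by lra.
  have [ds|ds] := leP s d; first by rewrite ler0_norm; lra.
  by nra.
have g0 : geometric `|x - y| (2^-1 : R) @ \oo --> (0 : R).
  by apply: cvg_geometric; rewrite ger0_norm //; lra.
apply/cvgrPdist_lt => e e0; near=> n.
rewrite distrC; apply: (le_lt_trans (key n)).
have: `|0 - geometric `|x - y| (2^-1 : R) n| < e.
  by near: n; exact: ((cvgrPdist_lt _ _).1 g0).
by rewrite sub0r normrN; apply: le_lt_trans; exact: ler_norm.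
Unshelve. all: by end_near. Qed.

(** At base 0 the power is 1 for exponent 0 and 0 otherwise, so continuity in the exponent holds
    there only away from 0. *)
Lemma powR_cvg_exp x (b : nat -> R) a : 0 <= x -> a != 0 ->
  b @ \oo --> a -> (fun n => x `^ b n) @ \oo --> x `^ a.
Proof.
move=> x0 a0 ba; have [->|xn0] := eqVneq x 0.
  rewrite powR0 //; apply: cvg_near_cst; near=> n; rewrite powR0 //.
  by near: n; exact: (cvgr_neq0 _ ba a0).
rewrite /powR (negbTE xn0).
apply: continuous_cvg; first exact: continuous_expR.
by apply: cvgM => //; exact: cvg_cst.
Unshelve. all: by end_near. Qed.

(** An abstract class of weights, instantiated later by [monotone_weight]. *)
Variable P : (R -> R -> R) -> Prop.
Hypothesis P_fst : P (fun x _ => x).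
Hypothesis P_snd : P (fun _ y => y).
Hypothesis P_arith : forall f g, P f -> P g ->
  P (fun x y => 2^-1 * (f x y + g x y)).
Hypothesis P_harm : forall f g, P f -> P g ->
  P (fun x y => harm (f x y) (g x y)).
Hypothesis P_lim : forall u f, (forall n, P (u n)) -> quadrant_cvg u f -> P f.

(** A constant sequence turns closure under limits into invariance under equality on the
    quadrant. *)
Lemma mean_closed_ext f g : (forall x y, 0 <= x -> 0 <= y -> f x y = g x y) ->
  P f -> P g.
Proof.
move=> fg Pf; apply: (P_lim (u := fun=> f)) => // x y x0 y0.
by rewrite fg //; exact: cvg_cst.
Qed.

Lemma mean_closed_geom f g :
  (forall x y, 0 <= x -> 0 <= y -> 0 <= f x y) ->
  (forall x y, 0 <= x -> 0 <= y -> 0 <= g x y) ->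
  P f -> P g -> P (fun x y => Num.sqrt (f x y * g x y)).
Proof.
move=> f0 g0 Pf Pg.
apply: (P_lim (u := fun n x y => (ahm n (f x y) (g x y)).1)); last first.
  by move=> x y x0 y0; apply: ahm_cvg; [exact: f0|exact: g0].
suff H n : P (fun x y => (ahm n (f x y) (g x y)).1) /\
           P (fun x y => (ahm n (f x y) (g x y)).2) by move=> n; case: (H n).
elim: n => [//|n [IH1 IH2]]; split.
- apply: mean_closed_ext (P_arith IH1 IH2) => x y _ _ /=.
  by case: (ahm n _ _).
- apply: mean_closed_ext (P_harm IH1 IH2) => x y _ _ /=.
  by case: (ahm n _ _).
Qed.

Lemma sqrt_powR x s : Num.sqrt (x `^ s) = x `^ (s / 2).
Proof.
have -> : x `^ s = (x `^ (s / 2)) ^+ 2.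
  by rewrite -powR_mulrn ?powR_ge0 // -powRrM divfK // pnatr_eq0.
by rewrite sqrtr_sqr ger0_norm // powR_ge0.
Qed.

Lemma mean_closed_midpoint a b : 0 <= a -> a <= 1 -> 0 <= b -> b <= 1 ->
  P (fun x y => x `^ a * y `^ (1 - a)) ->
  P (fun x y => x `^ b * y `^ (1 - b)) ->
  P (fun x y => x `^ ((a + b) / 2) * y `^ (1 - (a + b) / 2)).
Proof.
move=> a0 a1 b0 b1 Pa Pb; have pge0 (c x y : R) : 0 <= x -> 0 <= y ->
  0 <= x `^ c * y `^ (1 - c) by move=> _ _; rewrite mulr_ge0 ?powR_ge0.
have geoD (s t z : R) : 0 <= s -> 0 <= t ->
    Num.sqrt (z `^ s * z `^ t) = z `^ ((s + t) / 2).
  move=> s0 t0; rewrite -sqrt_powR; congr Num.sqrt.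
  (* At base 0 the addition law for exponents is delicate when they sum to 0; nonnegativity then
     makes both vanish. *)
  have [/eqP|st0] := eqVneq (s + t) 0; last by rewrite powRD // (negbTE st0).
  by rewrite paddr_eq0 // => /andP[/eqP-> /eqP->]; rewrite addr0 powRr0 mulr1.
apply: mean_closed_ext (mean_closed_geom (pge0 a) (pge0 b) Pa Pb) => x y x0 y0.
rewrite mulrACA sqrtrM ?mulr_ge0 ?powR_ge0 // !geoD //; try lra.
by congr (_ * _ `^ _); field.
Qed.

(** Bisection from the exponents 0 and 1, which give the two projections: each midpoint is a
    geometric mean, and the left endpoints converge to [a]. *)
Lemma mean_closed_powR a : 0 < a < 1 -> P (fun x y => x `^ a * y `^ (1 - a)).
Proof.
move=> /andP[a0 a1].
pose E c := P (fun x y => x `^ c * y `^ (1 - c)).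
have bisect n : exists l u, [/\ 0 <= l, u <= 1, l <= a <= u,
    u - l = 2^-1 ^+ n & E l /\ E u].
  elim: n => [|n [l [u [l0 u1 /andP[la au] ulE [El Eu]]]]].
    exists 0, 1; split=> //; [lra|by rewrite subr0 expr0|split].
      by apply: mean_closed_ext P_snd => x y x0 y0; rewrite powRr0 subr0 powRr1 // mul1r.
    by apply: mean_closed_ext P_fst => x y x0 y0; rewrite subrr powRr0 powRr1 // mulr1.
  have Em : E ((l + u) / 2) by apply: mean_closed_midpoint => //; lra.
  have [am|am] := leP a ((l + u) / 2).
    by exists l, ((l + u) / 2); split=> //; [lra|lra|rewrite exprS -ulE; field].
  by exists ((l + u) / 2), u; split=> //; [lra|lra|rewrite exprS -ulE; field].
have /choice[b bP] : forall n, exists b, E b /\ `|a - b| <= 2^-1 ^+ n.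
  move=> n; have [l [u [l0 u1 lau ulE [El Eu]]]] := bisect n.
  by exists l; split=> //; rewrite -ulE ger0_norm; lra.
have ba : b @ \oo --> a.
  have g0 : geometric 1 (2^-1 : R) @ \oo --> (0 : R).
    by apply: cvg_geometric; rewrite ger0_norm //; lra.
  apply/cvgrPdist_lt => e e0; near=> n.
  apply: (le_lt_trans (proj2 (bP n))).
  have: `|0 - geometric 1 (2^-1 : R) n| < e.
    by near: n; exact: ((cvgrPdist_lt _ _).1 g0).
  by rewrite sub0r normrN /= mul1r; apply: le_lt_trans; exact: ler_norm.
apply: (P_lim (u := fun n x y => x `^ b n * y `^ (1 - b n))).
  by move=> n; case: (bP n).
(* Since [a] is strictly between 0 and 1, both limit exponents are nonzero, as convergence at base 0
   requires. *)
move=> x y x0 y0; apply: cvgM; apply: powR_cvg_exp => //.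
- by rewrite gt_eqF.
- by rewrite subr_eq0 gt_eqF.
- by apply: cvgB => //; exact: cvg_cst.
Unshelve. all: by end_near. Qed.

End ClosureUnderMeans.

(** * Adjoints, tensor products, traces and positive matrices *)

Section Adjoint.
Variable R : realType.
Local Notation C := (R[i]).

Lemma adjE m n (A : 'M[C]_(m, n)) i j : adj A i j = (A j i)^*.
Proof. by rewrite !mxE. Qed.

Lemma adjK m n : cancel (@adj R m n) (@adj R n m).
Proof. exact: trmxCK. Qed.

Lemma adjM m n p (A : 'M[C]_(m, n)) (B : 'M[C]_(n, p)) :
  adj (A *m B) = adj B *m adj A.
Proof. by rewrite /adj trmx_mul map_mxM. Qed.

Lemma adjB m n (A B : 'M[C]_(m, n)) : adj (A - B) = adj A - adj B.
Proof. by apply/matrixP => i j; rewrite !mxE rmorphB. Qed.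

Lemma adj_sum (I : Type) (r : seq I) m n (F : I -> 'M[C]_(m, n)) :
  adj (\sum_(i <- r) F i) = \sum_(i <- r) adj (F i).
Proof.
apply/matrixP => i j; rewrite adjE !summxE rmorph_sum.
by apply: eq_bigr => k _; rewrite adjE.
Qed.

Lemma adj1 n : adj (1%:M : 'M[C]_n) = 1%:M.
Proof. by rewrite /adj trmx1 map_mx1. Qed.

Lemma adj_tens m n p q (A : 'M[C]_(m, n)) (B : 'M[C]_(p, q)) :
  adj (A *t B) = adj A *t adj B.
Proof. by rewrite /adj trmx_tens map_mxT. Qed.

Lemma mxtrace_tens m n (A : 'M[C]_m) (B : 'M[C]_n) :
  \tr (A *t B) = \tr A * \tr B.
Proof.
by rewrite /mxtrace mulr_sum; apply: eq_bigr => k _; rewrite mxE.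
Qed.

Lemma tens1mx1 m n : (1%:M : 'M[C]_m) *t (1%:M : 'M[C]_n) = 1%:M.
Proof.
apply/matrixP => i j; rewrite !mxE.
rewrite -(inj_eq (can_inj (@mxtens_unindexK m n))) xpair_eqE.
by case: (_ == _); case: (_ == _); rewrite ?mulr0 ?mul0r ?mul1r.
Qed.

Lemma tens_sumr (I : Type) (s : seq I) m n p q (A : 'M[C]_(m, n))
    (F : I -> 'M[C]_(p, q)) :
  \sum_(k <- s) A *t F k = A *t (\sum_(k <- s) F k).
Proof.
apply/matrixP => i j; rewrite summxE mxE summxE mulr_sumr.
by apply: eq_bigr => k _; rewrite mxE.
Qed.

(** Shifts a conjugation of [A] and [B] onto [X] and [Y]; serves both the passage to eigenbases and
    unitary covariance. *)
Lemma mxtrace_conj_cyc n (P Q A X B Y : 'M[C]_n) :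
  \tr (P *m A *m Q *m X *m (P *m B *m Q) *m Y)
  = \tr (A *m (Q *m X *m P) *m B *m (Q *m Y *m P)).
Proof.
transitivity (\tr (P *m (A *m (Q *m X *m P) *m B *m (Q *m Y)))).
  by rewrite !mulmxA.
by rewrite (mxtrace_mulC P) !mulmxA.
Qed.

(** Pairing with matrix units recovers the entries. Identities for partial traces can thus be
    checked on the dual side. *)
Lemma mxtrace_inj n (A B : 'M[C]_n) :
  (forall X, \tr (A *m X) = \tr (B *m X)) -> A = B.
Proof.
have trE (Y : 'M[C]_n) i j : \tr (Y *m delta_mx j i) = Y i j.
  rewrite /mxtrace (bigD1 i) //= [X in _ + X]big1 ?addr0 => [|k ki].
    rewrite mxE (bigD1 j) //= big1 ?addr0 => [|l lj]; first by rewrite mxE !eqxx mulr1.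
    by rewrite mxE (negbTE lj) mulr0.
  by rewrite mxE big1 // => l _; rewrite mxE (negbTE ki) andbF mulr0.
by move=> AB; apply/matrixP => i j; rewrite -!trE AB.
Qed.

Lemma hermP n (A : 'M[C]_n) : A \is hermsymmx <-> adj A = A.
Proof.
split=> [/is_hermitianmxP|h].
  by rewrite expr0 scale1r => {2}->.
by apply/is_hermitianmxP; rewrite expr0 scale1r -[LHS]h.
Qed.

Lemma unitary_adjK n (U : 'M[C]_n) : U \is unitarymx -> adj U *m U = 1%:M.
Proof. by move=> /unitarymxP /mulmx1C. Qed.

Lemma unitary_mulK n (U : 'M[C]_n) : U \is unitarymx -> U *m adj U = 1%:M.
Proof. by move=> /unitarymxP. Qed.

Lemma adj_unitary n (U : 'M[C]_n) : U \is unitarymx -> adj U \is unitarymx.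
Proof. by move=> uU; rewrite trmxC_unitary. Qed.

Lemma unitary_conjM n (U A B : 'M[C]_n) : U \is unitarymx ->
  (adj U *m A *m U) *m (adj U *m B *m U) = adj U *m (A *m B) *m U.
Proof.
by move=> uU; rewrite !mulmxA -(mulmxA _ U) (unitary_mulK uU) mulmx1.
Qed.

Lemma tens_unitary m n (U : 'M[C]_m) (V : 'M[C]_n) :
  U \is unitarymx -> V \is unitarymx -> U *t V \is unitarymx.
Proof.
move=> uU uV; apply/unitarymxP; rewrite -/(adj _) adj_tens tensmx_mul.
by rewrite (unitary_mulK uU) (unitary_mulK uV) tens1mx1.
Qed.

Lemma psd_conj m n (M : 'M[C]_(m, n)) (A : 'M[C]_n) :
  psdmx A -> psdmx (M *m A *m adj M).
Proof.
move=> [/hermP hA pA]; split; first by apply/hermP; rewrite !adjM adjK hA mulmxA.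
by move=> v; have := pA (v *m M); rewrite adjM !mulmxA.
Qed.

Lemma psd_sum (I : Type) (r : seq I) n (F : I -> 'M[C]_n) :
  (forall i, psdmx (F i)) -> psdmx (\sum_(i <- r) F i).
Proof.
move=> pF; split.
  by apply/hermP; rewrite adj_sum; apply: eq_bigr => i _; apply/hermP; case: (pF i).
move=> v; rewrite mulmx_sumr mulmx_suml summxE sumr_ge0 // => i _.
by case: (pF i).
Qed.

Lemma psd_trace_ge0 n (A : 'M[C]_n) : psdmx A -> 0 <= \tr A.
Proof.
move=> [_ pA]; apply: sumr_ge0 => i _; have := pA (delta_mx 0 i).
rewrite -rowE mxE (bigD1 i) //= big1 => [|j ji].
  by rewrite adjE !mxE !eqxx conjC1 mulr1 addr0.
by rewrite adjE !mxE eqxx (negbTE ji) conjC0 mulr0.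
Qed.

End Adjoint.

(** * Functional calculus of Hermitian matrices and its independence of the diagonalisation *)

Section FunctionalCalculus.
Variable R : realType.
Local Notation C := (R[i]).

Definition rdiag n (d : 'I_n -> R) : 'M[C]_n := diag_mx (\row_i (d i)%:C%C).

(** Taking real parts loses nothing for Hermitian matrices, whose spectrum is real. *)
Definition mxeig n (A : 'M[C]_n) (i : 'I_n) : R := complex.Re (spectral_diag A 0 i).

Definition mxfun n (A : 'M[C]_n) (f : R -> R) : 'M[C]_n :=
  adj (spectralmx A) *m rdiag (fun i => f (mxeig A i)) *m spectralmx A.

Lemma spectral_mxE n (A : 'M[C]_n) : A \is hermsymmx ->
  A = adj (spectralmx A) *m rdiag (mxeig A) *m spectralmx A.
Proof.
move=> hA; have /orthomx_spectralP e := hermitian_normalmx hA.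
rewrite {1}e (invmx_unitary (spectral_unitarymx A)) /rdiag.
suff -> : \row_i (mxeig A i)%:C%C = spectral_diag A by [].
apply/rowP => i; rewrite mxE /mxeig RRe_real //.
exact: (mxOverP (hermitian_spectral_diag_real hA)).
Qed.

Lemma mxpowRE n (A : 'M[C]_n) a : mxpowR A a = mxfun A (fun x => x `^ a).
Proof.
rewrite /mxpowR (invmx_unitary (spectral_unitarymx A)) /mxfun /rdiag.
suff -> : map_mx (fun c : C => ((complex.Re c) `^ a)%:C%C) (spectral_diag A)
        = \row_i (mxeig A i `^ a)%:C%C by [].
by apply/rowP => i; rewrite [LHS]mxE [RHS]mxE.
Qed.

Lemma eq_rdiag n (c d : 'I_n -> R) : c =1 d -> rdiag c = rdiag d.
Proof.
by move=> cd; rewrite /rdiag; apply/matrixP => i j; rewrite !mxE cd.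
Qed.

Lemma rdiag1 n : rdiag (fun=> 1) = 1%:M :> 'M[C]_n.
Proof. by apply/matrixP => i j; rewrite !mxE. Qed.

Lemma rdiagM n (c d : 'I_n -> R) : rdiag c *m rdiag d = rdiag (fun i => c i * d i).
Proof.
rewrite /rdiag mulmx_diag; apply/matrixP => i j.
by rewrite !mxE rmorphM.
Qed.

Lemma rdiag_tens m n (c : 'I_m -> R) (d : 'I_n -> R) : rdiag c *t rdiag d =
  rdiag (fun k => c (mxtens_unindex k).1 * d (mxtens_unindex k).2).
Proof.
apply/matrixP => i j; rewrite !mxE.
rewrite -(inj_eq (can_inj (@mxtens_unindexK m n))) xpair_eqE.
by case: (_ == _); case: (_ == _); rewrite ?mulr0n ?mulr1n ?mulr0 ?mul0r ?rmorphM.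
Qed.

Opaque spectralmx spectral_diag adj.

Lemma mxfun_id n (A : 'M[C]_n) : A \is hermsymmx -> mxfun A id = A.
Proof. by move=> hA; rewrite [RHS](spectral_mxE hA). Qed.

Lemma mxfun1 n (A : 'M[C]_n) : mxfun A (fun=> 1) = 1%:M.
Proof.
by rewrite /mxfun rdiag1 mulmx1 (unitary_adjK (spectral_unitarymx A)).
Qed.

Lemma mxfunM n (A : 'M[C]_n) f g :
  mxfun A f *m mxfun A g = mxfun A (fun x => f x * g x).
Proof.
by rewrite /mxfun (unitary_conjM _ _ (spectral_unitarymx A)) rdiagM.
Qed.

Lemma eq_mxfun n (A : 'M[C]_n) f g :
  (forall i, f (mxeig A i) = g (mxeig A i)) -> mxfun A f = mxfun A g.
Proof. by move=> fg; rewrite /mxfun (eq_rdiag fg). Qed.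

(** An eigenvalue is the value of the quadratic form at the corresponding row of [spectralmx A]. *)
Lemma mxeig_ge0 n (A : 'M[C]_n) i : psdmx A -> 0 <= mxeig A i.
Proof.
move=> [hA pA].
have uP := unitary_mulK (spectral_unitarymx A).
have := spectral_mxE hA; move: (spectralmx A) uP => P uP AE.
have PAP : P *m A *m adj P = rdiag (mxeig A).
  by rewrite {1}AE !mulmxA uP mul1mx -mulmxA uP mulmx1.
rewrite -ler0c; have := pA (row i P).
have -> : (row i P *m A *m adj (row i P)) 0 0 = (P *m A *m adj P) i i.
  rewrite -row_mul !mxE; apply: eq_bigr => k _.
  by rewrite adjE [row i (P *m A) _ _]mxE adjE [row i P _ _]mxE.
by rewrite PAP /rdiag mxE eqxx mxE.
Qed.

(* A matrix intertwining two real diagonal matrices only links equal eigenvalues. *)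
Lemma rdiag_intertwine n (W : 'M[C]_n) (c d : 'I_n -> R) (f : R -> R) :
  rdiag c *m W = W *m rdiag d ->
  rdiag (fun i => f (c i)) *m W = W *m rdiag (fun i => f (d i)).
Proof.
move=> WE; apply/matrixP => i j; move/matrixP/(_ i j): WE.
rewrite /rdiag !mul_diag_mx !mul_mx_diag !mxE [RHS]mulrC.
move=> /eqP; rewrite -subr_eq0 -mulrBl mulf_eq0 => /orP[|/eqP->].
  by rewrite subr_eq0 => /eqP/complexI->; rewrite mulrC.
by rewrite mulr0 mul0r.
Qed.

(** The unitary [P *m adj U] intertwines the two diagonals, hence also their images under [f]. So
    [mxfun] may be computed from any unitary diagonalisation. *)
Lemma rdiag_unique n (P U : 'M[C]_n) (c d : 'I_n -> R) (f : R -> R) :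
  P \is unitarymx -> U \is unitarymx ->
  adj P *m rdiag c *m P = adj U *m rdiag d *m U ->
  adj P *m rdiag (fun i => f (c i)) *m P
  = adj U *m rdiag (fun i => f (d i)) *m U.
Proof.
move=> uP uU PU.
have WE : rdiag c *m (P *m adj U) = (P *m adj U) *m rdiag d.
  transitivity (P *m (adj P *m rdiag c *m P) *m adj U).
    by rewrite !mulmxA (unitary_mulK uP) mul1mx.
  by rewrite PU !mulmxA -mulmxA (unitary_mulK uU) mulmx1.
transitivity (adj P *m (rdiag (fun i => f (c i)) *m (P *m adj U)) *m U).
  by rewrite -!mulmxA (unitary_adjK uU) mulmx1.
by rewrite (rdiag_intertwine f WE) !mulmxA (unitary_adjK uP) mul1mx.
Qed.

Lemma mxfun_unique n (A U : 'M[C]_n) (d : 'I_n -> R) f :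
  A \is hermsymmx -> U \is unitarymx -> A = adj U *m rdiag d *m U ->
  mxfun A f = adj U *m rdiag (fun i => f (d i)) *m U.
Proof.
move=> hA uU AE; apply: rdiag_unique uU _; first exact: spectral_unitarymx.
by rewrite -AE -spectral_mxE.
Qed.

Lemma herm_conj m n (M : 'M[C]_(m, n)) (A : 'M[C]_n) :
  A \is hermsymmx -> M *m A *m adj M \is hermsymmx.
Proof. by move=> /hermP hA; apply/hermP; rewrite !adjM adjK hA mulmxA. Qed.

Lemma mxfun_conj n (A U : 'M[C]_n) f : A \is hermsymmx -> U \is unitarymx ->
  mxfun (U *m A *m adj U) f = U *m mxfun A f *m adj U.
Proof.
move=> hA uU; have uP := spectral_unitarymx A.
have uPU := mul_unitarymx uP (adj_unitary uU).
rewrite (@mxfun_unique _ _ _ (mxeig A) _ (herm_conj U hA) uPU).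
  by rewrite /mxfun adjM adjK !mulmxA.
by rewrite {1}(spectral_mxE hA) adjM adjK !mulmxA.
Qed.

(** The tensor product of the eigenbases diagonalises [A *t B]; positivity makes the power
    multiplicative on products of eigenvalues. *)
Lemma mxpowR_tens m n (A : 'M[C]_m) (B : 'M[C]_n) a : psdmx A -> psdmx B ->
  mxpowR (A *t B) a = mxpowR A a *t mxpowR B a.
Proof.
move=> pA pB; have [hA _] := pA; have [hB _] := pB.
pose d (k : 'I_(m * n)) := mxeig A (mxtens_unindex k).1 * mxeig B (mxtens_unindex k).2.
have uAB := tens_unitary (spectral_unitarymx A) (spectral_unitarymx B).
have hAB : A *t B \is hermsymmx.
  by apply/hermP; rewrite adj_tens ((hermP A).1 hA) ((hermP B).1 hB).
rewrite !mxpowRE (@mxfun_unique _ _ _ d _ hAB uAB).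
  rewrite /mxfun -!tensmx_mul adj_tens rdiag_tens.
  rewrite (@eq_rdiag _ _ (fun k => mxeig A (mxtens_unindex k).1 `^ a *
                                   mxeig B (mxtens_unindex k).2 `^ a)) // => k.
  by rewrite /d powRM // mxeig_ge0.
rewrite {1}(spectral_mxE hA) {1}(spectral_mxE hB) -!tensmx_mul adj_tens.
by rewrite rdiag_tens.
Qed.

End FunctionalCalculus.

Opaque spectralmx spectral_diag adj.

(** * Quadratic forms in an eigenbasis, under means and limits of weights *)

Section QuasiEntropy.
Local Open Scope classical_set_scope.
Variable R : realType.
Local Notation C := (R[i]).

(** The squared modulus, valued in [R] so that forms are compared in the real order. *)
Definition sqn (z : C) : R := complex.Re z ^+ 2 + complex.Im z ^+ 2.

Lemma sqnE (z : C) : (sqn z)%:C%C = z * z^*.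
Proof. by rewrite /sqn add_Re2_Im2 normCK. Qed.

Definition eigcoord n (A X : 'M[C]_n) : 'M[C]_n :=
  spectralmx A *m X *m adj (spectralmx A).

Lemma eigcoordD n (A X Y : 'M[C]_n) :
  eigcoord A (X + Y) = eigcoord A X + eigcoord A Y.
Proof. by rewrite /eigcoord mulmxDr mulmxDl. Qed.

Lemma eigcoordK n (A Y : 'M[C]_n) :
  eigcoord A (adj (spectralmx A) *m Y *m spectralmx A) = Y.
Proof.
have uP := unitary_mulK (spectral_unitarymx A).
by rewrite /eigcoord !mulmxA uP mul1mx -mulmxA uP mulmx1.
Qed.

Definition qform n (A : 'M[C]_n) (f : R -> R -> R) (X : 'M[C]_n) : R :=
  \sum_i \sum_j f (mxeig A i) (mxeig A j) * sqn (eigcoord A X i j).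

Lemma trace_rdiag n (c d : 'I_n -> R) (Y : 'M[C]_n) :
  \tr (rdiag c *m Y *m rdiag d *m adj Y)
  = (\sum_i \sum_j c i * d j * sqn (Y i j))%:C%C.
Proof.
rewrite rmorph_sum /mxtrace; apply: eq_bigr => i _.
rewrite rmorph_sum mxE; apply: eq_bigr => j _.
transitivity ((c i)%:C%C * (d j)%:C%C * (Y i j * (Y i j)^*)).
  by rewrite /rdiag mul_mx_diag mul_diag_mx !mxE; ring.
by rewrite -sqnE -!rmorphM.
Qed.

Lemma qformE n (A X : 'M[C]_n) (g h : R -> R) :
  \tr (mxfun A g *m X *m mxfun A h *m adj X)
  = (qform A (fun x y => g x * h y) X)%:C%C.
Proof.
rewrite /qform -trace_rdiag /mxfun /eigcoord !adjM adjK.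
by rewrite mxtrace_conj_cyc !mulmxA.
Qed.

(** The defect is [2 * (f * y - g * z) ^+ 2 / (f + g)]; it vanishes exactly when [f * y = g * z]. *)
Lemma harm_sqr_le (f g y z : R) : 0 <= f -> 0 <= g ->
  harm f g * (y + z) ^+ 2 <= 2 * (f * y ^+ 2 + g * z ^+ 2).
Proof.
move=> f0 g0; rewrite /harm.
have [fg0|fg0] := eqVneq (f + g) 0.
  have -> : f = 0 by lra.
  by rewrite !mul0r add0r mulr_ge0 // mulr_ge0 // sqr_ge0.
have fgp : 0 < f + g by rewrite lt_neqAle eq_sym fg0 addr_ge0.
rewrite -subr_ge0.
have -> : 2 * (f * y ^+ 2 + g * z ^+ 2) - f * g / (2^-1 * (f + g)) * (y + z) ^+ 2
          = 2 * (f * y - g * z) ^+ 2 / (f + g) by field.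
by apply: divr_ge0; [rewrite mulr_ge0 ?sqr_ge0 ?ler0n|exact: ltW].
Qed.

Lemma sqn_harm_le (f g : R) (y z : C) : 0 <= f -> 0 <= g ->
  harm f g * sqn (y + z) <= 2 * (f * sqn y + g * sqn z).
Proof.
move=> f0 g0; rewrite /sqn !raddfD /=.
have := harm_sqr_le (complex.Re y) (complex.Re z) f0 g0.
have := harm_sqr_le (complex.Im y) (complex.Im z) f0 g0.
rewrite !mulrDr; lra.
Qed.

(** The share [t] with [f * t = g * (1 - t)], the equality case above. If [f] and [g] both vanish it
    is 0, and both sides of the identity below are 0. *)
Definition split_weight (f g : R) : R := g / (f + g).

Lemma sqn_harm_split (f g : R) (x : C) : 0 <= f -> 0 <= g ->
  let t := split_weight f g in
  harm f g * sqn x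
  = 2 * (f * sqn (t%:C%C * x) + g * sqn ((1 - t)%:C%C * x)).
Proof.
move=> f0 g0 /=; rewrite /harm /split_weight; case: x => a b.
rewrite /sqn; simpc => /=.
have [fg0|fg0] := eqVneq (f + g) 0.
  have -> : f = 0 by lra.
  have -> : g = 0 by lra.
  by rewrite !(mul0r, mulr0, addr0).
by field.
Qed.

Section HarmonicForm.
Variables (n : nat) (A : 'M[C]_n) (f g : R -> R -> R).
Hypothesis pA : psdmx A.
Hypothesis f0 : forall x y, 0 <= x -> 0 <= y -> 0 <= f x y.
Hypothesis g0 : forall x y, 0 <= x -> 0 <= y -> 0 <= g x y.
Let h x y := harm (f x y) (g x y).

Lemma qform_harm_le (Y Z : 'M[C]_n) :
  qform A h (Y + Z) <= 2 * (qform A f Y + qform A g Z).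
Proof.
rewrite /qform -big_split mulr_sumr; apply: ler_sum => i _.
rewrite -big_split mulr_sumr; apply: ler_sum => j _ /=.
rewrite eigcoordD mxE; apply: sqn_harm_le; first by apply: f0; exact: mxeig_ge0.
by apply: g0; exact: mxeig_ge0.
Qed.

(** The infimum is attained: each entry is split optimally in the eigenbasis of [A], and the parts
    are rotated back. *)
Lemma qform_harm_split (X : 'M[C]_n) : exists Y Z,
  X = Y + Z /\ qform A h X = 2 * (qform A f Y + qform A g Z).
Proof.
pose P := spectralmx A.
pose t i j := split_weight (f (mxeig A i) (mxeig A j)) (g (mxeig A i) (mxeig A j)).
pose Y' := \matrix_(i, j) ((t i j)%:C%C * eigcoord A X i j).
pose Z' := \matrix_(i, j) ((1 - t i j)%:C%C * eigcoord A X i j).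
exists (adj P *m Y' *m P), (adj P *m Z' *m P); split.
  rewrite -mulmxDl -mulmxDr.
  have -> : Y' + Z' = eigcoord A X.
    by apply/matrixP => i j; rewrite !mxE -mulrDl -rmorphD /= addrC subrK mul1r.
  have uP := unitary_adjK (spectral_unitarymx A).
  by rewrite /eigcoord -/P !mulmxA uP mul1mx -mulmxA uP mulmx1.
rewrite /qform -big_split mulr_sumr; apply: eq_bigr => i _.
rewrite -big_split mulr_sumr; apply: eq_bigr => j _ /=.
rewrite !eigcoordK [Y' i j]mxE [Z' i j]mxE; apply: sqn_harm_split.
  by apply: f0; exact: mxeig_ge0.
by apply: g0; exact: mxeig_ge0.
Qed.

End HarmonicForm.

Lemma qform_arith n (A X : 'M[C]_n) f g :
  qform A (fun x y => 2^-1 * (f x y + g x y)) X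
  = 2^-1 * (qform A f X + qform A g X).
Proof.
rewrite /qform -big_split mulr_sumr; apply: eq_bigr => i _.
rewrite -big_split mulr_sumr; apply: eq_bigr => j _ /=.
by ring.
Qed.

Lemma qform_cvg n (A X : 'M[C]_n) u f : psdmx A -> quadrant_cvg u f ->
  (fun k => qform A (u k) X) @ \oo --> qform A f X.
Proof.
move=> pA uf; rewrite /qform.
apply: (@cvg_big R 'I_n +%R 0 xpredT (@add_continuous R)) => i _.
apply: (@cvg_big R 'I_n +%R 0 xpredT (@add_continuous R)) => j _.
apply: cvgM; last exact: cvg_cst.
by apply: uf; exact: mxeig_ge0.
Qed.

End QuasiEntropy.

(** * Monotonicity of the forms under trace-preserving Kraus maps *)

Section Monotonicity.
Variable R : realType.
Local Notation C := (R[i]).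
Variables (m n r : nat) (M : 'I_r -> 'M[C]_(m, n)).
Hypothesis M_tp : \sum_i adj (M i) *m M i = 1%:M.

(** The operators [M i] may be rectangular, so that the partial trace is covered. *)
Definition kraus_map (A : 'M[C]_n) : 'M[C]_m := \sum_i M i *m A *m adj (M i).
Definition kraus_dual (X : 'M[C]_m) : 'M[C]_n := \sum_i adj (M i) *m X *m M i.

Lemma kraus_map_psd A : psdmx A -> psdmx (kraus_map A).
Proof. by move=> pA; apply: psd_sum => i; exact: psd_conj. Qed.

Lemma kraus_dualD X Y : kraus_dual (X + Y) = kraus_dual X + kraus_dual Y.
Proof.
by rewrite /kraus_dual -big_split; apply: eq_bigr => i _; rewrite mulmxDr mulmxDl.
Qed.

Lemma kraus_dual_adj X : kraus_dual (adj X) = adj (kraus_dual X).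
Proof.
rewrite /kraus_dual adj_sum; apply: eq_bigr => i _.
by rewrite !adjM adjK mulmxA.
Qed.

Lemma trace_kraus A X : \tr (kraus_map A *m X) = \tr (A *m kraus_dual X).
Proof.
rewrite /kraus_map /kraus_dual mulmx_suml mulmx_sumr !raddf_sum.
apply: eq_bigr => i _ /=.
by rewrite -!mulmxA mxtrace_mulC -!mulmxA.
Qed.

(* With [N i = X^* M i - M i (dual X)^*] one has
   [\sum_i (N i)^* N i = dual (X X^* ) - dual X (dual X)^*]. *)
Lemma kraus_dual_schwarz A X : psdmx A ->
  \tr (A *m (kraus_dual X *m adj (kraus_dual X))) <= \tr (kraus_map A *m (X *m adj X)).
Proof.
move=> pA; rewrite trace_kraus -subr_ge0 -raddfB -mulmxBr.
set J := kraus_dual X.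
pose N i := adj X *m M i - M i *m adj J.
have -> : kraus_dual (X *m adj X) - J *m adj J = \sum_i adj (N i) *m N i.
  have -> : \sum_i adj (N i) *m N i =
     \sum_i (adj (M i) *m (X *m adj X) *m M i - (adj (M i) *m X *m M i) *m adj J
      - (J *m (adj (M i) *m adj X *m M i) - J *m (adj (M i) *m M i) *m adj J)).
    apply: eq_bigr => i _; rewrite /N adjB !adjM !adjK mulmxBl !mulmxBr.
    by rewrite !mulmxA.
  (* By trace preservation the last term sums to [J *m adj J], cancelling one of the two cross
     terms. *)
  rewrite !sumrB -!mulmx_suml -!mulmx_sumr -/(kraus_dual (adj X)) kraus_dual_adj M_tp mulmx1 -/J.
  by rewrite subrr subr0.
rewrite mulmx_sumr raddf_sum /=; apply: sumr_ge0 => i _.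
(* Cyclicity gives the trace of [N i *m A *m adj (N i)], a positive matrix. *)
rewrite mulmxA mxtrace_mulC mulmxA.
exact/psd_trace_ge0/psd_conj.
Qed.

(** Nonnegativity is carried along because the harmonic step needs it of both weights. *)
Definition monotone_weight A (f : R -> R -> R) :=
  (forall x y, 0 <= x -> 0 <= y -> 0 <= f x y) /\
  forall X, qform A f (kraus_dual X) <= qform (kraus_map A) f X.

Section Weights.
Variable A : 'M[C]_n.
Hypothesis pA : psdmx A.
Let pA' : psdmx (kraus_map A) := kraus_map_psd pA.

Lemma qform_fst k (B X : 'M[C]_k) : psdmx B ->
  (qform B (fun x _ => x) X)%:C%C = \tr (B *m (X *m adj X)).
Proof.
move=> [hB _]; have -> : qform B (fun x _ => x) X = qform B (fun x y => id x * 1) X.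
  by rewrite /qform; apply: eq_bigr => i _; apply: eq_bigr => j _; rewrite mulr1.
by rewrite -qformE mxfun1 (mxfun_id hB) mulmx1 !mulmxA.
Qed.

Lemma qform_snd k (B X : 'M[C]_k) : psdmx B ->
  (qform B (fun _ y => y) X)%:C%C = \tr (B *m (adj X *m X)).
Proof.
move=> [hB _]; have -> : qform B (fun _ y => y) X = qform B (fun x y => 1 * id y) X.
  by rewrite /qform; apply: eq_bigr => i _; apply: eq_bigr => j _; rewrite mul1r.
by rewrite -qformE mxfun1 (mxfun_id hB) mul1mx -mulmxA mxtrace_mulC mulmxA.
Qed.

Lemma monotone_fst : monotone_weight A (fun x _ => x).
Proof.
split=> // X; rewrite -lecR (qform_fst _ pA) (qform_fst _ pA').
exact: kraus_dual_schwarz.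
Qed.

(** The Schwarz inequality for [adj X], since this weight reverses the order of [X] and its
    adjoint. *)
Lemma monotone_snd : monotone_weight A (fun _ y => y).
Proof.
split=> // X; rewrite -lecR (qform_snd _ pA) (qform_snd _ pA').
have := kraus_dual_schwarz (adj X) pA.
by rewrite kraus_dual_adj !adjK.
Qed.

Lemma monotone_arith f g : monotone_weight A f -> monotone_weight A g ->
  monotone_weight A (fun x y => 2^-1 * (f x y + g x y)).
Proof.
move=> [f0 mf] [g0 mg]; split=> [x y x0 y0|X].
  by rewrite mulr_ge0 ?invr_ge0 ?ler0n // addr_ge0 ?f0 ?g0.
rewrite !qform_arith ler_wpM2l ?invr_ge0 ?ler0n //.
exact: lerD (mf X) (mg X).
Qed.

(* The form of a harmonic mean is an infimum over decompositions of its argument;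
   the dual map sends decompositions of [X] to decompositions of [dual X]. *)
Lemma monotone_harm f g : monotone_weight A f -> monotone_weight A g ->
  monotone_weight A (fun x y => harm (f x y) (g x y)).
Proof.
move=> [f0 mf] [g0 mg]; split=> [x y x0 y0|X].
  by rewrite /harm divr_ge0 ?mulr_ge0 ?invr_ge0 ?ler0n ?addr_ge0 ?f0 ?g0.
have [Y [Z [-> ->]]] := qform_harm_split pA' f0 g0 X.
rewrite kraus_dualD; apply: le_trans (qform_harm_le pA f0 g0 _ _) _.
by rewrite ler_wpM2l ?ler0n //; exact: lerD (mf Y) (mg Z).
Qed.

Lemma monotone_lim u f : (forall k, monotone_weight A (u k)) ->
  quadrant_cvg u f -> monotone_weight A f.
Proof.
move=> mu uf; split=> [x y x0 y0|X].
  apply: (cvgr_to_ge (uf x y x0 y0)); apply: nearW => k.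
  by case: (mu k) => + _; apply.
have c1 := qform_cvg (X := kraus_dual X) pA uf; have c2 := qform_cvg (X := X) pA' uf.
apply: (ler_cvg_to c1 c2); apply: nearW => k.
by case: (mu k).
Qed.

End Weights.

(** The monotonicity form of Lieb's concavity theorem: for fixed [A], the monotone weights have all
    the closure properties that [mean_closed_powR] asks for. *)
Lemma lieb_monotonicity (a : R) A X : 0 < a < 1 -> psdmx A ->
  \tr (mxpowR A a *m kraus_dual X *m mxpowR A (1 - a) *m adj (kraus_dual X)) <=
  \tr (mxpowR (kraus_map A) a *m X *m mxpowR (kraus_map A) (1 - a) *m adj X).
Proof.
move=> a01 pA; rewrite !mxpowRE !qformE lecR.
have [_] : monotone_weight A (fun x y => x `^ a * y `^ (1 - a)); last exact.
apply: mean_closed_powR => //.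
- exact: monotone_fst.
- exact: monotone_snd.
- by move=> f g; exact: monotone_arith.
- by move=> f g; exact: monotone_harm.
- by move=> u f; exact: monotone_lim.
Qed.

End Monotonicity.

(** * The partial trace as a Kraus map, and local operations *)

Section PartialTrace.
Variable R : realType.
Local Notation C := (R[i]).
Variables nA nB : nat.

(** The identity on the first factor tensored with the [k]-th basis functional on the second. *)
Definition ptr_kraus (k : 'I_nB) : 'M[C]_(nA, nA * nB) :=
  \matrix_(i, p) (p == mxtens_index (i, k))%:R.

Lemma ptr_krausE k i p : ptr_kraus k i p =
  ((mxtens_unindex p).1 == i)%:R * ((mxtens_unindex p).2 == k)%:R.
Proof.
rewrite mxE -(inj_eq (can_inj (@mxtens_unindexK nA nB))) mxtens_indexK xpair_eqE.
by rewrite -mulnb natrM.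
Qed.

Lemma kraus_dual_ptr (X : 'M[C]_nA) : kraus_dual ptr_kraus X = X *t 1%:M.
Proof.
apply/matrixP => p q; rewrite summxE [RHS]mxE.
set p1 := (mxtens_unindex p).1; set p2 := (mxtens_unindex p).2.
set q1 := (mxtens_unindex q).1; set q2 := (mxtens_unindex q).2.
transitivity (\sum_k (p2 == k)%:R * (q2 == k)%:R * X p1 q1 : C).
  apply: eq_bigr => k _.
  have L j : (adj (ptr_kraus k) *m X) p j = (p2 == k)%:R * X p1 j.
    rewrite mxE (bigD1 p1) //= big1 ?addr0 => [|i ip].
      by rewrite adjE ptr_krausE eqxx mul1r conjC_nat.
    by rewrite adjE ptr_krausE eq_sym (negbTE ip) mul0r conjC0 mul0r.
  rewrite mxE (bigD1 q1) //= big1 ?addr0 => [|j jq].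
    by rewrite L ptr_krausE eqxx mul1r mulrAC.
  by rewrite ptr_krausE eq_sym (negbTE jq) mul0r mulr0.
rewrite (bigD1 p2) //= big1 ?addr0 => [|k kp].
  by rewrite mxE eqxx mul1r mulrC eq_sym.
by rewrite eq_sym (negbTE kp) !mul0r.
Qed.

(** Trace preservation is unitality of the dual map. *)
Lemma ptr_kraus_tp : \sum_k adj (ptr_kraus k) *m ptr_kraus k = 1%:M.
Proof.
rewrite -tens1mx1 -kraus_dual_ptr.
by apply: eq_bigr => k _; rewrite mulmx1.
Qed.

Lemma kraus_map_ptr (rho : 'M[C]_(nA * nB)) :
  kraus_map ptr_kraus rho = ptraceB rho.
Proof.
apply/matrixP => i j; rewrite summxE [RHS]mxE; apply: eq_bigr => k _.
have L q : (ptr_kraus k *m rho) i q = rho (mxtens_index (i, k)) q.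
  rewrite mxE (bigD1 (mxtens_index (i, k))) //= big1 ?addr0 => [|p pk].
    by rewrite mxE eqxx mul1r.
  by rewrite mxE (negbTE pk) mul0r.
rewrite mxE (bigD1 (mxtens_index (j, k))) //= big1 ?addr0 => [|p pk].
  by rewrite L adjE mxE eqxx conjC1 mulr1.
by rewrite adjE [ptr_kraus _ _ _]mxE (negbTE pk) conjC0 mulr0.
Qed.

Lemma trace_ptraceB (rho : 'M[C]_(nA * nB)) X :
  \tr (ptraceB rho *m X) = \tr (rho *m (X *t 1%:M)).
Proof. by rewrite -kraus_map_ptr trace_kraus kraus_dual_ptr. Qed.

Lemma ptraceB_tens (rhoA : 'M[C]_nA) (rhoB : 'M[C]_nB) :
  ptraceB (rhoA *t rhoB) = \tr rhoB *: rhoA.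
Proof.
apply: mxtrace_inj => X.
by rewrite trace_ptraceB tensmx_mul mulmx1 mxtrace_tens -scalemxAl mxtraceZ mulrC.
Qed.

Lemma ptraceB_conj (U : 'M[C]_nA) (V : 'M[C]_nB) rho : V \is unitarymx ->
  ptraceB ((U *t V) *m rho *m adj (U *t V)) = U *m ptraceB rho *m adj U.
Proof.
move=> uV; apply: mxtrace_inj => X.
have cyc k (W A Y : 'M[C]_k) :
    \tr (W *m A *m adj W *m Y) = \tr (A *m (adj W *m Y *m W)).
  by rewrite -!mulmxA mxtrace_mulC -!mulmxA.
rewrite trace_ptraceB !cyc trace_ptraceB adj_tens !tensmx_mul mulmx1.
by rewrite (unitary_adjK uV).
Qed.

Lemma kraus_dual_id_tens s (L : 'I_s -> 'M[C]_nB) (X : 'M[C]_nA) :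
  is_channel L -> kraus_dual (@id_tens_ch R nA nB s L) (X *t 1%:M) = X *t 1%:M.
Proof.
move=> hL; rewrite -{2}hL -tens_sumr; apply: eq_bigr => i _.
by rewrite /id_tens_ch adj_tens adj1 !tensmx_mul mul1mx !mulmx1.
Qed.

Lemma id_tens_ch_tp s (L : 'I_s -> 'M[C]_nB) : is_channel L ->
  \sum_i adj (@id_tens_ch R nA nB s L i) *m @id_tens_ch R nA nB s L i = 1%:M.
Proof.
move=> hL; rewrite -[RHS]tens1mx1 -(kraus_dual_id_tens _ hL) tens1mx1.
by apply: eq_bigr => i _; rewrite mulmx1.
Qed.

(** No signalling: the dual of a channel on the second factor fixes every test matrix
    [X *t 1%:M]. *)
Lemma ptraceB_id_tens s (L : 'I_s -> 'M[C]_nB) rho : is_channel L ->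
  ptraceB (apply_ch (@id_tens_ch R nA nB s L) rho) = ptraceB rho.
Proof.
move=> hL; apply: mxtrace_inj => X; rewrite !trace_ptraceB.
by rewrite -/(kraus_map _ _) trace_kraus kraus_dual_id_tens.
Qed.

End PartialTrace.

(** * Behaviour of [T_alpha] under conjugation and tensoring, and the theorem *)

Section Difference.
Variable R : realType.
Local Notation C := (R[i]).

(** Each summand has the shape compared in [lieb_monotonicity], so inequalities can be proved one
    Kraus operator at a time. *)
Lemma T_alphaE n r (a : R) (rho : 'M[C]_n) (K : 'I_r -> 'M[C]_n) :
  T_alpha a rho K = 1 - \sum_i
    \tr (mxpowR rho a *m K i *m mxpowR rho (1 - a) *m adj (K i)).
Proof.
rewrite /T_alpha /apply_ch; congr (1 - _); rewrite mulmx_sumr raddf_sum.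
by apply: eq_bigr => i _; rewrite /= !mulmxA.
Qed.

Lemma eq_T_alpha n r (a : R) (rho : 'M[C]_n) (K L : 'I_r -> 'M[C]_n) :
  K =1 L -> T_alpha a rho K = T_alpha a rho L.
Proof. by move=> KL; rewrite !T_alphaE; under eq_bigr do rewrite KL. Qed.

Lemma T_alpha_conj n r (a : R) (rho U : 'M[C]_n) (K : 'I_r -> 'M[C]_n) :
  rho \is hermsymmx -> U \is unitarymx ->
  T_alpha a (U *m rho *m adj U) K = T_alpha a rho (ch_conj U K).
Proof.
move=> hrho uU; rewrite !T_alphaE; congr (1 - _); apply: eq_bigr => i _.
rewrite !mxpowRE !(mxfun_conj _ hrho uU) /ch_conj !adjM adjK.
by rewrite mxtrace_conj_cyc !mulmxA.
Qed.

Lemma T_alpha_tens nA nB r (a : R) (rhoA : 'M[C]_nA) (rhoB : 'M[C]_nB)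
    (K : 'I_r -> 'M[C]_nA) : 0 < a < 1 -> is_state rhoA -> is_state rhoB ->
  T_alpha a (rhoA *t rhoB) (@ch_tens_id R nA nB r K) = T_alpha a rhoA K.
Proof.
move=> /andP[a0 a1] [pA _] [pB trB].
rewrite !T_alphaE; congr (1 - _); apply: eq_bigr => i _.
rewrite !(mxpowR_tens _ pA pB) /ch_tens_id adj_tens adj1 !tensmx_mul !mulmx1 mxtrace_tens.
(* The second factor contributes only the trace of [rhoB], which is 1. *)
have -> : mxpowR rhoB a *m mxpowR rhoB (1 - a) = rhoB.
  rewrite !mxpowRE mxfunM -[RHS](mxfun_id (proj1 pB)); apply: eq_mxfun => j.
  have x0 := mxeig_ge0 j pB.
  by rewrite -powRD addrC subrK ?powRr1 // oner_eq0.
by rewrite trB mulr1.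
Qed.

End Difference.

Theorem theorem2 (R : realType) (a : R) (ha : 0 < a < 1) (nA nB r : nat)
  (K : 'I_r -> 'M[R[i]]_nA) (hK : is_channel K)
  (rho : 'M[R[i]]_(nA * nB)) (hrho : is_state rho) :
  (* (i) *)
  (0 <= DT_alpha a rho K /\
   forall (rhoA : 'M[R[i]]_nA) (rhoB : 'M[R[i]]_nB),
     is_state rhoA -> is_state rhoB -> rho = rhoA *t rhoB ->
     DT_alpha a rho K = 0) /\
  (* (ii) *)
  (forall (UA : 'M[R[i]]_nA) (UB : 'M[R[i]]_nB),
     UA \is unitarymx -> UB \is unitarymx ->
     DT_alpha a ((UA *t UB) *m rho *m adj (UA *t UB)) K
     = DT_alpha a rho (ch_conj UA K)) /\
  (* (iii) *)
  (forall (s : nat) (L : 'I_s -> 'M[R[i]]_nB), is_channel L ->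
     DT_alpha a (apply_ch (@id_tens_ch R nA nB s L) rho) K
     <= DT_alpha a rho K).
Proof.
have [prho _] := hrho; have [hermrho _] := prho.
split; [split|split].
- rewrite /DT_alpha !T_alphaE subr_ge0 lerD2l lerN2.
  apply: ler_sum => i _.
  (* [K i *t 1%:M] is the dual of the partial trace at [K i], and the reduced state is the image of
     [rho]. *)
  rewrite /ch_tens_id -kraus_dual_ptr -kraus_map_ptr.
  exact: (lieb_monotonicity (ptr_kraus_tp R nA nB) _ ha prho).
- move=> rhoA rhoB sA sB ->.
  by rewrite /DT_alpha (T_alpha_tens _ ha sA sB) ptraceB_tens (proj2 sB) scale1r subrr.
- move=> UA UB uA uB; have uAB := tens_unitary uA uB.
  have hermA : ptraceB rho \is hermsymmx.
    by rewrite -kraus_map_ptr; case: (kraus_map_psd (@ptr_kraus R nA nB) prho).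
  rewrite /DT_alpha (ptraceB_conj _ _ uB).
  have -> : T_alpha a (UA *m ptraceB rho *m adj UA) K
      = T_alpha a (ptraceB rho) (ch_conj UA K) := T_alpha_conj a K hermA uA.
  suff -> : T_alpha a ((UA *t UB) *m rho *m adj (UA *t UB)) (@ch_tens_id R nA nB r K)
      = T_alpha a rho (@ch_tens_id R nA nB r (ch_conj UA K)) by [].
  (* Conjugating [K i *t 1%:M] by [UA *t UB] affects only the first factor, as [adj UB *m UB] is the
     identity. *)
  rewrite (T_alpha_conj _ _ hermrho uAB); apply: eq_T_alpha => i.
  rewrite /ch_conj /ch_tens_id adj_tens !tensmx_mul.
  by rewrite mulmx1 (unitary_adjK uB).
(* The reduced state is unchanged, so the terms on the first system cancel. *)
- move=> s L hL; rewrite /DT_alpha (ptraceB_id_tens _ hL) lerD2r !T_alphaE lerD2l lerN2.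
  (* Only the two occurrences on the side of [rho] are rewritten as values of the dual map, which
     fixes them. *)
  apply: ler_sum => i _; rewrite /ch_tens_id -{1 2}(kraus_dual_id_tens _ hL).
  exact: (lieb_monotonicity (id_tens_ch_tp nA hL) _ ha prho).
Qed.
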